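(* Let $0<q\le s\le\infty$. Assume that $$\mathbf{Q}_2(S\circ T,a,c,g)\le\mathbf{Q}_1(S,Ta,c,g)\quad\text{and}\quad\mathbf{H}_1(Ta,c,g,\psi)\le\mathbf{M}(T,a,c,g,\psi)$$ for every $T\in\mathcal{H}$, $S\in\mathcal{H}_1$, $a\in A$, $c\in C$, $g\in G$ and $\psi\in W$. Then $$\left[\mathfrak{P}_s^{\mathbf{H}_1-\mathbf{Q}_1}(B,D),\pi_{\mathbf{H}_1\mathbf{Q}_1,s}\right]\circ\left[\mathfrak{M}^{\mathbf{H}-\mathbf{M}}_{((s;q),q)}(A,B),\mathbf{HM}_{((s;q),q)}\right]\subseteq\left[\mathfrak{P}_q^{\mathbf{H}-\mathbf{Q}_2}(A,D),\pi_{\mathbf{H}\mathbf{Q}_2,q}\right];$$ that is, if $S$ is $\mathbf{H}_1$--$\mathbf{Q}_1$-abstract $s$-summing and $T$ is $\mathbf{H}$--$\mathbf{M}$-$((s;q),q)$-mixing, then $S\circ T$ is $\mathbf{H}$--$\mathbf{Q}_2$-abstract $q$-summing and $\pi_{\mathbf{H}\mathbf{Q}_2,q}(S\circ T)\le\pi_{\mathbf{H}_1\mathbf{Q}_1,s}(S)\cdot\mathbf{HM}_{((s;q),q)}(T)$.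
   Context: $A,B,C,C_1,D$ are non-void sets; $G$ is a Banach space; $K,W$ are compact Hausdorff topological spaces; $\mathcal{H},\mathcal{H}_1,\mathcal{H}_2$ are non-void families of mappings from $A$ into $B$, from $B$ into $D$, and from $A$ into $D$, respectively. The following maps are arbitrary: $\mathbf{H}:A\times C\times G\times K\to\mathbb{R}$, $\mathbf{H}_1:B\times C_1\times G\times W\to\mathbb{R}$, $\mathbf{Q}_1:\mathcal{H}_1\times B\times C_1\times G\to\mathbb{R}$, $\mathbf{Q}_2:\mathcal{H}_2\times A\times C\times G\to\mathbb{R}$, $\mathbf{M}:\mathcal{H}\times A\times C\times G\times W\to\mathbb{R}$. For the two assumed inequalities to make sense, $S\circ T\in\mathcal{H}_2$ whenever $T\in\mathcal{H}$, $S\in\mathcal{H}_1$, and $C\subseteq C_1$. Expressions $[\sum|\cdot|^p]^{1/p}$ with $p=\infty$ are read as suprema. Abstract summing maps: $S\in\mathcal{H}_1$ is $\mathbf{H}_1$--$\mathbf{Q}_1$-abstract $p$-summing if there is $\delta>0$ with $$\left[\sum_{j=1}^m|\sigma_j|^p|\mathbf{Q}_1(S,b_j,c_j,g_j)|^p\right]^{1/p}\le\delta\sup_{\psi\in W}\left[\sum_{j=1}^m|\sigma_j|^p|\mathbf{H}_1(b_j,c_j,g_j,\psi)|^p\right]^{1/p}$$ for all $m\in\mathbb{N}$, nonzero $\sigma_j\in\mathbb{R}$, $b_j\in B$, $c_j\in C_1$, $g_j\in G$; the infimum of such $\delta$ is $\pi_{\mathbf{H}_1\mathbf{Q}_1,p}(S)$,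 and $\mathfrak{P}_p^{\mathbf{H}_1-\mathbf{Q}_1}(B,D)$ is the class of all such maps. Likewise $R\in\mathcal{H}_2$ is $\mathbf{H}$--$\mathbf{Q}_2$-abstract $p$-summing, with constant $\pi_{\mathbf{H}\mathbf{Q}_2,p}(R)$ and class $\mathfrak{P}_p^{\mathbf{H}-\mathbf{Q}_2}(A,D)$, if the same holds with $\mathbf{Q}_2(R,a_j,c_j,g_j)$ on the left and $\sup_{\varphi\in K}$ and $\mathbf{H}(a_j,c_j,g_j,\varphi)$ on the right, for all $a_j\in A$, $c_j\in C$, $g_j\in G$. Mixing maps: let $\frac1r+\frac1s=\frac1q$. For $T\in\mathcal{H}$, nonzero reals $\sigma_j$ and $a_j\in A$, $c_j\in C$, $g_j\in G$ set $$\mathfrak{m}^{\mathbf{M}}_{(s;q)}\left((\sigma_j,T,a_j,c_j,g_j,\psi)\right)_{j=1}^m=\inf\left[\sum_{j=1}^m|\tau_j|^r\right]^{1/r}\sup_{\psi\in W}\left[\sum_{j=1}^m\left|\frac{\sigma_j}{\tau_j}\right|^s|\mathbf{M}(T,a_j,c_j,g_j,\psi)|^s\right]^{1/s},$$ the infimum being over all families of nonzero numbers $\tau_1,\dots,\tau_m$. $T$ is $\mathbf{H}$--$\mathbf{M}$-$((s;q),q)$-mixing if there is $\delta\ge0$ with $$\mathfrak{m}^{\mathbf{M}}_{(s;q)}\left((\sigma_j,T,a_j,c_j,g_j,\psi)\right)_{j=1}^m\le\delta\sup_{\varphi\in K}\left[\sum_{j=1}^m|\sigma_j|^q|\mathbf{H}(a_j,c_j,g_j,\varphi)|^q\right]^{1/q}$$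 for all $m\in\mathbb{N}$, nonzero $\sigma_j\in\mathbb{R}$, $a_j\in A$, $c_j\in C$, $g_j\in G$; the infimum of such $\delta$ is $\mathbf{HM}_{((s;q),q)}(T)$, and $\mathfrak{M}^{\mathbf{H}-\mathbf{M}}_{((s;q),q)}(A,B)$ is the class of all such maps from $A$ into $B$.
   Formalization: The two assumed inequalities are taken between absolute values, |Q2(S∘T,a,c,g)| ≤ |Q1(S,Ta,c,g)| and |H1(Ta,c,g,ψ)| ≤ |M(T,a,c,g,ψ)|; for signed real maps the printed version fails (H=H1=M=Q1=0, Q2=-1). *)

(* Defs.v *)
From HB Require Import structures.
From mathcomp Require Import all_boot all_order all_algebra.
From mathcomp Require Import all_classical all_reals all_analysis.

Set Implicit Arguments.
Unset Strict Implicit.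
Unset Printing Implicit Defensive.

Import Order.TTheory GRing.Theory Num.Theory.
Import numFieldNormedType.Exports.

Local Open Scope classical_set_scope.
Local Open Scope ring_scope.

(* [\sum_j |x j|^p]^{1/p}, read as a supremum when p = +oo.  It is only used
   for 0 < p <= +oo; the value at -oo is a placeholder. *)
Definition lpsum (R : realType) (p : \bar R) (m : nat) (x : 'I_m -> R) : R :=
  match p with
  | r%:E => (\sum_(j < m) `|x j| `^ r) `^ r^-1
  | +oo%E => \big[Num.max/0]_(j < m) `|x j|
  | -oo%E => 0
  end.

(* Supremum in [0, +oo] of a nonnegative function, which need not be bounded.
   The point 0 is adjoined because ereal_sup set0 = -oo; it is immaterial
   unless V is empty. *)
Definition nnsup (R : realType) (V : Type) (f : V -> R) : \bar R :=
  ereal_sup ([set 0%E] `|` range (fun v => (f v)%:E)).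

(* [Maps] is the family of admissible maps.  Since |a|^p |b|^p = |a b|^p, the
   weighted sums \sum_j |sigma_j|^p |Q_j|^p are lpsum's of the products. *)
Definition summing_constants (R : realType) (Maps X Y Z V : Type)
    (H : X -> Y -> Z -> V -> R) (Q : Maps -> X -> Y -> Z -> R)
    (p : \bar R) (S : Maps) : set R :=
  [set delta : R | 0 < delta /\
    forall (m : nat) (sigma : 'I_m -> R) (x : 'I_m -> X) (y : 'I_m -> Y)
           (z : 'I_m -> Z),
      (forall j, sigma j != 0) ->
      ((lpsum p (fun j => sigma j * Q S (x j) (y j) (z j))%R)%:E <=
       delta%:E *
       nnsup (fun v => lpsum p (fun j => sigma j * H (x j) (y j) (z j) v)%R))%E].

Definition abstract_summing (R : realType) (Maps X Y Z V : Type)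
    (H : X -> Y -> Z -> V -> R) (Q : Maps -> X -> Y -> Z -> R)
    (p : \bar R) (S : Maps) : Prop :=
  summing_constants H Q p S !=set0.

Definition pi_summing (R : realType) (Maps X Y Z V : Type)
    (H : X -> Y -> Z -> V -> R) (Q : Maps -> X -> Y -> Z -> R)
    (p : \bar R) (S : Maps) : R :=
  inf (summing_constants H Q p S).

(* The exponent r is meant to be the one given by 1/r + 1/s = 1/q. *)
Definition mixed_value (R : realType) (Maps X Y Z V : Type)
    (M : Maps -> X -> Y -> Z -> V -> R) (r s : \bar R) (T : Maps) (m : nat)
    (sigma : 'I_m -> R) (x : 'I_m -> X) (y : 'I_m -> Y) (z : 'I_m -> Z) :
    \bar R :=
  ereal_inf
    [set ((lpsum r tau)%:E *
          nnsup (fun v => lpsum s (fun j =>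
            sigma j / tau j * M T (x j) (y j) (z j) v)%R))%E
    | tau in [set tau : 'I_m -> R | forall j, tau j != 0]].

Definition mixing_constants (R : realType) (Maps X Y Z U V : Type)
    (H : X -> Y -> Z -> U -> R) (M : Maps -> X -> Y -> Z -> V -> R)
    (r s q : \bar R) (T : Maps) : set R :=
  [set delta : R | 0 <= delta /\
    forall (m : nat) (sigma : 'I_m -> R) (x : 'I_m -> X) (y : 'I_m -> Y)
           (z : 'I_m -> Z),
      (forall j, sigma j != 0) ->
      (mixed_value M r s T sigma x y z <=
       delta%:E *
       nnsup (fun u => lpsum q (fun j => sigma j * H (x j) (y j) (z j) u)%R))%E].

Definition mixing (R : realType) (Maps X Y Z U V : Type)
    (H : X -> Y -> Z -> U -> R) (M : Maps -> X -> Y -> Z -> V -> R)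
    (r s q : \bar R) (T : Maps) : Prop :=
  mixing_constants H M r s q T !=set0.

Definition HM_mixing (R : realType) (Maps X Y Z U V : Type)
    (H : X -> Y -> Z -> U -> R) (M : Maps -> X -> Y -> Z -> V -> R)
    (r s q : \bar R) (T : Maps) : R :=
  inf (mixing_constants H M r s q T).

(* Composition as an operation HH1 x HH -> HH2 between families of maps. *)
Definition family_comp (A B D : Type) (HH : set (A -> B)) (HH1 : set (B -> D))
    (HH2 : set (A -> D))
    (HHcomp : forall (S : B -> D) (T : A -> B), HH1 S -> HH T -> HH2 (S \o T))
    (S : HH1) (T : HH) : HH2 :=
  exist _ (\val S \o \val T)
    (mem_set (HHcomp _ _ (set_mem (valP S)) (set_mem (valP T)))).

(* Main.v *)
Require Import Defs.
From HB Require Import structures.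
From mathcomp Require Import all_boot all_order all_algebra.
From mathcomp Require Import all_classical all_reals all_analysis.

Set Implicit Arguments.
Unset Strict Implicit.
Unset Printing Implicit Defensive.

Import Order.TTheory GRing.Theory Num.Theory.
Import numFieldNormedType.Exports.

Local Open Scope classical_set_scope.
Local Open Scope ring_scope.

(* For every admissible weight tau, the generalized Hoelder inequality with
   1/r + 1/s = 1/q, applied to sigma_j Q_2 = tau_j ((sigma_j / tau_j) Q_2),
   bounds the q-sum of Q_2 by |tau|_r times the s-sum of (sigma / tau) Q_1; the
   latter is controlled by the summing constant of S and the M-term of T.
   The infimum over tau is the mixed value of T, which the mixing constant
   bounds.  As a mixing constant may be 0 while a summing constant may not, the
   products of constants are only limits of summing constants of S o T. *)

(** Young's inequality is applied termwise to [a] and [b] divided by their norms; summed over [i],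
    the right-hand sides give [p^-1 + p'^-1 = 1]. *)
Lemma hoelder_sum (R : realType) (I : finType) (a b : I -> R) (p p' : R) :
  (forall i, 0 <= a i) -> (forall i, 0 <= b i) ->
  0 < p -> 0 < p' -> p^-1 + p'^-1 = 1 ->
  \sum_i a i * b i <= (\sum_i a i `^ p) `^ p^-1 * (\sum_i b i `^ p') `^ p'^-1.
Proof.
move=> a0 b0 p0 p'0 pp'.
have sum_powR_eq0 (c : I -> R) (t : R) : \sum_i c i `^ t = 0 -> forall i, c i = 0.
  move=> /eqP; rewrite psumr_eq0 => [/allP c0 i|i _]; last exact: powR_ge0.
  by apply/(@powR_eq0_eq0 _ _ t)/eqP/(implyP (c0 i _)) => //; rewrite mem_index_enum.
move XE: (\sum_i a i `^ p) => X; move YE: (\sum_i b i `^ p') => Y.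
have X0 : 0 <= X by rewrite -XE; apply: sumr_ge0 => i _; exact: powR_ge0.
have Y0 : 0 <= Y by rewrite -YE; apply: sumr_ge0 => i _; exact: powR_ge0.
(* Normalising needs nonzero norms. If one of them vanishes, then so does that whole family, and the
   left side is 0. *)
have [X_eq0|Xneq0] := eqVneq X 0.
  rewrite big1 ?mulr_ge0 ?powR_ge0// => i _.
  by rewrite (sum_powR_eq0 a p) ?mul0r// XE.
have [Y_eq0|Yneq0] := eqVneq Y 0.
  rewrite big1 ?mulr_ge0 ?powR_ge0// => i _.
  by rewrite (sum_powR_eq0 b p') ?mulr0// YE.
have {Xneq0}X0 : 0 < X by rewrite lt0r Xneq0.
have {Yneq0}Y0 : 0 < Y by rewrite lt0r Yneq0.
have powRVK (Z t : R) : 0 < t -> 0 < Z -> (Z `^ t^-1) `^ t = Z.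
  by move=> t0 Z0; rewrite -powRrM mulVf ?gt_eqF// powRr1 ?ltW.
have powR_div (c t w : R) : 0 <= c -> 0 < w -> (c / w) `^ t = c `^ t / w `^ t.
  move=> c0 w0; rewrite powRM// ?invr_ge0 ?(ltW w0)//; congr (_ * _).
  by rewrite -[in LHS]powR_inv1 ?(ltW w0)// powRAC powR_inv1// powR_ge0.
have := powRVK X p p0 X0; have := powR_gt0 p^-1 X0.
have := powRVK Y p' p'0 Y0; have := powR_gt0 p'^-1 Y0.
(* The norms [u] and [v] are kept abstract: only their positivity, [u]^ p = X[and]v [^ p' = Y]
   matter below. *)
move: (X `^ _) (Y `^ _) => u v v0 vY u0 uX.
have young i : a i * b i / (u * v) <= a i `^ p / X / p + b i `^ p' / Y / p'.
  have := conjugate_powR (divr_ge0 (a0 i) (ltW u0))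
    (divr_ge0 (b0 i) (ltW v0)) p0 p'0 pp'.
  by rewrite mulf_div (powR_div _ p _ (a0 i) u0) (powR_div _ p' _ (b0 i) v0) uX vY.
rewrite -[leRHS]mul1r -ler_pdivrMr ?mulr_gt0// mulr_suml.
apply: le_trans (ler_sum _ (fun i _ => young i)) _.
by rewrite big_split/= -!mulr_suml XE YE !divff ?gt_eqF// !mul1r pp'.
Qed.

Section LpSum.
Context {R : realType}.
Implicit Types p q r s : \bar R.

Lemma lpsum_ge0 p (m : nat) (x : 'I_m -> R) : 0 <= lpsum p x.
Proof. by case: p => [p||]//=; [exact: powR_ge0|exact: bigmax_ge_id]. Qed.

Lemma le_lpsum p (m : nat) (x y : 'I_m -> R) : (0 < p)%E ->
  (forall j, `|x j| <= `|y j|) -> lpsum p x <= lpsum p y.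
Proof.
case: p => [p||]//= p0 xy; last by apply: le_bigmax2 => j _.
rewrite lte_fin in p0; apply: ge0_ler_powR; first by rewrite invr_ge0 ltW.
- by rewrite nnegrE sumr_ge0// => j _; exact: powR_ge0.
- by rewrite nnegrE sumr_ge0// => j _; exact: powR_ge0.
- by apply: ler_sum => j _; apply: ge0_ler_powR; rewrite ?nnegrE ?(ltW p0).
Qed.

(** The endpoint of the Hoelder inequality where one exponent is infinite: every [|b j|] is replaced
    by the maximum, which then factors out. *)
Lemma lpsumM_le_max p (m : nat) (a b : 'I_m -> R) : (0 < p)%E ->
  lpsum p (fun j => a j * b j) <= lpsum p a * lpsum +oo%E b.
Proof.
have bB j : `|b j| <= lpsum +oo%E b by exact: (le_bigmax _ (fun j => `|b j|)).
have := lpsum_ge0 +oo%E b; move: (lpsum _ b) bB => B bB B0.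
case: p => [p||]//= p0; last first.
  apply: bigmax_le => [|j _]; first by rewrite mulr_ge0// bigmax_ge_id.
  by rewrite normrM ler_pM//; exact: (le_bigmax _ (fun j => `|a j|)).
rewrite lte_fin in p0.
have -> : B = (B `^ p) `^ p^-1 by rewrite -powRrM divff ?gt_eqF// powRr1.
rewrite -powRM ?powR_ge0 ?sumr_ge0//.
apply: ge0_ler_powR; first by rewrite invr_ge0 ltW.
- by rewrite nnegrE sumr_ge0// => j _; exact: powR_ge0.
- by rewrite nnegrE mulr_ge0 ?powR_ge0 ?sumr_ge0// => j _; exact: powR_ge0.
- rewrite mulr_suml; apply: ler_sum => j _; rewrite normrM powRM//.
  by rewrite ler_wpM2l ?powR_ge0// ge0_ler_powR ?nnegrE ?(ltW p0).
Qed.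

(** If [r] or [s] is infinite, the other one equals [q] and the endpoint case applies. Otherwise
    this is Hoelder for [|a j|]^ q[and]|b j| [^ q] with the conjugate exponents [r / q] and
    [s / q]. *)
Lemma lpsumM_le q r s (m : nat) (a b : 'I_m -> R) :
  (0 < q)%E -> (0 < r)%E -> (0 < s)%E -> (r^-1 + s^-1 = q^-1)%E ->
  lpsum q (fun j => a j * b j) <= lpsum r a * lpsum s b.
Proof.
case: s => [s| |]// q0 r0 s0; last first.
  by rewrite invey adde0 => /(can_inj inveK) rq; rewrite -rq in q0 *; exact: lpsumM_le_max.
case: r r0 => [r| |]// r0; last first.
  rewrite invey add0e => /(can_inj inveK) <-; rewrite mulrC.
  under eq_fun do rewrite mulrC.
  exact: lpsumM_le_max.
rewrite !lte_fin in r0 s0.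
rewrite !inver !gt_eqF//; case: q q0 => [q| |]// q0; last first.
  (* An infinite [q] would force [r^-1 + s^-1 = 0], impossible for finite positive [r] and [s]. *)
  by rewrite invey => -[] /eqP; rewrite paddr_eq0 ?invr_ge0 ?(ltW r0) ?(ltW s0)// invr_eq0 gt_eqF.
rewrite lte_fin in q0; rewrite inver gt_eqF// => -[rsq] /=.
have powRrq (c t : R) : (c `^ q) `^ (t / q) = c `^ t.
  by rewrite -powRrM mulrCA divff ?gt_eqF// mulr1.
have powRq (c t : R) : c `^ t^-1 = (c `^ (t / q)^-1) `^ q^-1.
  by rewrite -powRrM invf_div mulrAC divff ?gt_eqF// mul1r.
rewrite (powRq _ r) (powRq _ s) -powRM ?powR_ge0//.
apply: ge0_ler_powR; first by rewrite invr_ge0 ltW.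
- by rewrite nnegrE sumr_ge0// => j _; exact: powR_ge0.
- by rewrite nnegrE mulr_ge0 ?powR_ge0.
under eq_bigr do rewrite normrM powRM//.
under [X in _ <= X `^ _ * _]eq_bigr do rewrite -powRrq.
under [X in _ <= _ * X `^ _]eq_bigr do rewrite -powRrq.
apply: hoelder_sum; rewrite ?divr_gt0//.
by rewrite !invf_div -mulrDr rsq divff// gt_eqF.
Qed.

Lemma nnsup_ge0 (V : Type) (f : V -> R) : (0 <= nnsup f)%E.
Proof. by apply: ereal_sup_ubound; left. Qed.

Lemma le_nnsup (V : Type) (f g : V -> R) : (forall v, f v <= g v) ->
  (nnsup f <= nnsup g)%E.
Proof.
move=> fg; apply: ge_ereal_sup => _ [->|[v _ <-]]; first exact: nnsup_ge0.
by apply: (@le_trans _ _ (g v)%:E); [rewrite lee_fin|apply: ereal_sup_ubound; right; exists v].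
Qed.

End LpSum.

Lemma le_mul_inf (R : realType) (A B : set R) (x : R) :
  A !=set0 -> B !=set0 -> lbound A 0 -> lbound B 0 ->
  (forall a b, A a -> B b -> x <= a * b) -> x <= inf A * inf B.
Proof.
move=> A0 B0 lA lB xAB.
have mul_inf (E : set R) (y c : R) : E !=set0 -> 0 <= c ->
    (forall e, E e -> y <= c * e) -> y <= c * inf E.
  (* For [c = 0] one cannot divide by [c]; any element of [E] then yields [y <= 0]. *)
  move=> E0; rewrite le0r => /predU1P[->|c0] yE.
    by case: E0 => e /yE; rewrite !mul0r.
  rewrite mulrC -ler_pdivrMr//; apply: lb_le_inf => // e /yE.
  by rewrite ler_pdivrMr// mulrC.
apply: (mul_inf) => // [|b Bb]; first exact: lb_le_inf.
rewrite mulrC; apply: mul_inf => // [|a Aa]; first exact: lB.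
by rewrite mulrC; exact: xAB.
Qed.

Theorem proposition12 (R : realType) (A B C1 D : Type) (C : set C1)
    (F : numFieldType) (G : completeNormedModType F) (K W : topologicalType)
    (HH : set (A -> B)) (HH1 : set (B -> D)) (HH2 : set (A -> D))
    (H : A -> C -> G -> K -> R)
    (H1 : B -> C1 -> G -> W -> R)
    (Q1 : HH1 -> B -> C1 -> G -> R)
    (Q2 : HH2 -> A -> C -> G -> R)
    (M : HH -> A -> C -> G -> W -> R)
    (HHcomp : forall (S : B -> D) (T : A -> B), HH1 S -> HH T -> HH2 (S \o T))
    (q r s : \bar R) :
  [set: A] !=set0 -> [set: B] !=set0 -> [set: C1] !=set0 -> C !=set0 ->
  [set: D] !=set0 -> HH !=set0 -> HH1 !=set0 -> HH2 !=set0 ->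
  compact [set: K] -> hausdorff_space K ->
  compact [set: W] -> hausdorff_space W ->
  (0 < q)%E -> (q <= s)%E -> (0 < r)%E -> (r^-1 + s^-1 = q^-1)%E ->
  (forall (T : HH) (S : HH1) (a : A) (c : C) (g : G),
      `|Q2 (family_comp HHcomp S T) a c g| <= `|Q1 S (\val T a) (\val c) g|) ->
  (forall (T : HH) (a : A) (c : C) (g : G) (psi : W),
      `|H1 (\val T a) (\val c) g psi| <= `|M T a c g psi|) ->
  forall (S : HH1) (T : HH),
    abstract_summing H1 Q1 s S ->
    mixing H M r s q T ->
    abstract_summing H Q2 q (family_comp HHcomp S T) /\
    pi_summing H Q2 q (family_comp HHcomp S T) <=
      pi_summing H1 Q1 s S * HM_mixing H M r s q T.
Proof.
move=> _ _ _ _ _ _ _ _ _ _ _ _ q0 qs r0 rsq leQ leH S T sumS mixT.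
have s0 := lt_le_trans q0 qs.
have comp_const d1 d2 d : summing_constants H1 Q1 s S d1 ->
    mixing_constants H M r s q T d2 -> d1 * d2 < d ->
    summing_constants H Q2 q (family_comp HHcomp S T) d.
  move=> [d10 sumd1] [d20 mixd2] d12.
  split=> [|m sigma a c g sigma0]; first exact: le_lt_trans (mulr_ge0 (ltW d10) d20) d12.
  set N := nnsup _; set L := lpsum _ _.
  apply: (@le_trans _ _ ((d1 * d2)%:E * N)%E); last first.
    by rewrite lee_wpmul2r ?nnsup_ge0// lee_fin ltW.
  rewrite EFinM -muleA; apply: (@le_trans _ _ (d1%:E * mixed_value M r s T sigma a c g)%E); last first.
    by rewrite lee_wpmul2l ?lee_fin ?(ltW d10)//; exact: mixd2.
  (* Since [d1] is positive, it can be moved to the left, which leaves a lower bound for an infimum,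
     checked for each [tau]; it is then moved back. *)
  rewrite -lee_pdivrMl//; apply: le_ereal_inf_tmp => _ [tau /= tau0 <-].
  rewrite lee_pdivrMl// muleCA.
  have sigmatau0 j : sigma j / tau j != 0 by rewrite mulf_neq0 ?invr_eq0.
  have LM : L <= lpsum r tau *
      lpsum s (fun j => sigma j / tau j * Q1 S (\val T (a j)) (\val (c j)) (g j)).
    (* The passage from [Q2] to [Q1] comes first, inside the [q]-sum; the factor [tau j] cancels
       there. *)
    apply: le_trans (lpsumM_le _ _ q0 r0 s0 rsq).
    apply: le_lpsum => // j; rewrite mulrA (mulrC (tau j)) divfK//.
    by rewrite !normrM ler_wpM2l.
  move: LM; rewrite -lee_fin => /le_trans; apply.
  rewrite EFinM lee_wpmul2l ?lee_fin ?lpsum_ge0//.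
  (* The summing inequality of [S] is used at the image points of [T], with the weights
     [sigma j / tau j]. *)
  apply: (le_trans (sumd1 _ _ (fun j => \val T (a j)) (fun j => \val (c j)) g sigmatau0)).
  rewrite lee_wpmul2l ?lee_fin ?(ltW d10)//; apply: le_nnsup => psi.
  by apply: le_lpsum => // j; rewrite !normrM ler_wpM2l// -normrM.
split.
  (* The added 1 is arbitrary slack, giving the strict inequality that [comp_const] asks for. *)
  case: sumS mixT => d1 Sd1 [d2 Td2]; exists (d1 * d2 + 1).
  by apply: comp_const Sd1 Td2 _; rewrite ltrDl.
apply: le_mul_inf => // [d [/ltW]|d []|d1 d2 Sd1 Td2]//.
apply/ler_addgt0Pr => e e0; apply: ge_inf; first by exists 0 => d [/ltW].
by apply: comp_const Sd1 Td2 _; rewrite ltrDl.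
Qed.
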